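(* Let $d\ge2$ and let $\mathbf{M}=(M_1,\dots,M_n)$ be a POVM on $\mathbb{C}^d$ with $M_i=\alpha_i\ket{\psi_i}\bra{\psi_i}$ (unit vectors $\ket{\psi_i}$), $n\le2d^2$ and $\alpha_i\le\frac1d$. Let $C>0$ be such that $r=Cd$ is a positive integer, and let $\mathcal{S}=\{S_\beta\}_{\beta=1}^r$ be the random partition of $[n]$ obtained by assigning each $i\in[n]$ independently to $S_\beta$ with $\beta$ uniform in $[r]$. Let $\delta\in(0,1]$ satisfy $\delta^3\ge\frac{3C}{2d}(1+\log(4Cd))$. Then with probability at least $1/4$ both of the following hold: (i) $q(\mathbf{M},\mathcal{S})\ge\frac{1}{3.44+2C\log d}$; (ii) $|S_\beta|\le\frac2C(1+\delta)d$ for all $\beta\in[r]$. (Here $\log$ is the natural logarithm.)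
   Context: A POVM on $\mathbb{C}^d$ is a tuple of positive semidefinite operators summing to $\mathbb{I}_d$. For a partition $\mathcal{S}=\{S_\beta\}$ of $[n]$, $q(\mathbf{M},\mathcal{S})=\left(\sum_\beta\left\|\sum_{i\in S_\beta}M_i\right\|\right)^{-1}$, with $\|\cdot\|$ the operator norm (empty sums contribute $0$). *)

(* Defs.v *)
From HB Require Import structures.
From mathcomp Require Import all_boot all_order all_algebra.
From mathcomp Require Import boolp classical_sets reals exp.
From mathcomp Require Import complex.
Set Implicit Arguments. Unset Strict Implicit. Unset Printing Implicit Defensive.
Import Order.TTheory GRing.Theory Num.Theory.
Local Open Scope ring_scope.
Local Open Scope classical_set_scope.

Section Defs.
Variable R : realType.
Local Notation C := (complex R).

Definition cconj (z : C) : C := @Complex R (@complex.Re R z) (- @complex.Im R z).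

Definition adjmx m n (A : 'M[C]_(m, n)) : 'M[C]_(n, m) :=
  \matrix_(i, j) cconj (A j i).

Definition vnorm2 d (v : 'cV[C]_d) : R :=
  \sum_(i < d) ((@complex.Re R (v i 0)) ^+ 2 + (@complex.Im R (v i 0)) ^+ 2).

Definition opnorm d (A : 'M[C]_d) : R :=
  sup [set Num.sqrt (vnorm2 (A *m v)) | v in [set v : 'cV[C]_d | vnorm2 v = 1]].

Definition hermitian d (A : 'M[C]_d) : Prop := adjmx A = A.

Definition psd d (A : 'M[C]_d) : Prop :=
  hermitian A /\ forall v : 'cV[C]_d, 0 <= @complex.Re R ((adjmx v *m A *m v) 0 0).

Definition is_POVM d n (M : 'I_n -> 'M[C]_d) : Prop :=
  (forall i, psd (M i)) /\ \sum_(i < n) M i = 1%:M.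

(* q(M, S) for the partition S_beta = {i | f i = beta}, beta in [r] *)
Definition qval d n r (M : 'I_n -> 'M[C]_d) (f : {ffun 'I_n -> 'I_r}) : R :=
  (\sum_(b < r) opnorm (\sum_(i < n | f i == b) M i))^-1.

End Defs.

(* Main.v *)
Require Import Defs.
From HB Require Import structures.
From mathcomp Require Import all_boot all_order all_algebra.
From mathcomp Require Import boolp classical_sets reals topology normedtype.
From mathcomp Require Import sequences exp.
From mathcomp Require Import complex.
From mathcomp Require Import ring lra.
Import Order.TTheory GRing.Theory Num.Theory.
Import numFieldNormedType.Exports.
Set Implicit Arguments. Unset Strict Implicit. Unset Printing Implicit Defensive.
Local Open Scope ring_scope.

(** Part (i) is a matrix Chernoff bound in expectation for sums of independent
    rank-one matrices, proved without Lieb's theorem. Let [T] be a truncation of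
    the exponential series, [H] positive semidefinite, [v] a unit vector and
    [P = v v*]. Expanding [(H + x P)^k] and using that [P] has rank one reduces
    the variation of [tr (H + x P)^k] to products of moments [v* H^m v], which
    are compared by Chebyshev's sum inequality for the spectral measure of [v]:
      [k x v* H^(k-1) v <= tr (H + x P)^k - tr H^k <= v* ((H + x)^k - H^k) v].
    Summing over [k], for [a <= 1] and any constant [K >= e - 1],
      [(1 - p) tr T(H) + p tr T(H + a P) <= tr T(H + p K a P)],
    so the random summands of a block can be replaced one at a time by their
    scaled means. This gives [E exp(d |M_S|) <= d exp(K d / r)] for a block [S];
    Jensen's inequality, summation over the blocks and Markov's inequality bound
    the failure probability of (i) by 1/2. The failure probability of (ii) is at
    most 1/4 by a scalar Chernoff bound and a union bound. *)

(** * Rank-one updates of positive semidefinite matrices *)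

Section PositiveSemidefinite.
Local Open Scope sesquilinear_scope.
Variable C : numClosedFieldType.

Definition psdmx n (A : 'M[C]_n) :=
  A^t* = A /\ forall v : 'cV[C]_n, 0 <= (v^t* *m A *m v) 0 0.

Lemma psdmx_add n (A B : 'M[C]_n) : psdmx A -> psdmx B -> psdmx (A + B).
Proof.
move=> [hA pA] [hB pB]; split=> [|v].
  by rewrite linearD /= map_mxD hA hB.
by rewrite mulmxDr mulmxDl mxE addr_ge0.
Qed.

Lemma psdmx_scale n (a : C) (A : 'M[C]_n) : 0 <= a -> psdmx A -> psdmx (a *: A).
Proof.
move=> a0 [hA pA]; split=> [|v].
  by rewrite linearZ /= map_mxZ hA; congr (_ *: _); apply: geC0_conj.
by rewrite -scalemxAr -scalemxAl mxE mulr_ge0.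
Qed.

Lemma psdmx0 n : psdmx (0 : 'M[C]_n).
Proof.
by split=> [|v]; rewrite ?trmx0 ?map_mx0 // mulmx0 mul0mx mxE.
Qed.

Lemma psdmx_sum n (I : Type) (s : seq I) (P : pred I) (F : I -> 'M[C]_n) :
  (forall i, P i -> psdmx (F i)) -> psdmx (\sum_(i <- s | P i) F i).
Proof.
move=> hF; apply: (big_ind (@psdmx n)) => //; [exact: psdmx0|exact: psdmx_add].
Qed.

Lemma trmxC_mul_self n (v : 'cV[C]_n) : (v^t* *m v) 0 0 = \sum_i `|v i 0| ^+ 2.
Proof. by rewrite mxE; apply: eq_bigr => i _; rewrite !mxE normCK mulrC. Qed.

Lemma psdmx_outer n (u : 'cV[C]_n) : psdmx (u *m u^t*).
Proof.
split=> [|v]; first by rewrite trmx_mul map_mxM trmxCK.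
have -> : v^t* *m (u *m u^t*) *m v = (u^t* *m v)^t* *m (u^t* *m v).
  by rewrite trmx_mul map_mxM trmxCK !mulmxA.
by rewrite trmxC_mul_self sumr_ge0 // => i _; rewrite exprn_ge0.
Qed.

Lemma unitarymx_conj n (U : 'M[C]_n) : U \is unitarymx -> U^t* *m U = 1%:M.
Proof. by move=> hU; rewrite -invmx_unitary // mulVmx ?unitarymx_unit. Qed.

Lemma psdmx_spectral n (A : 'M[C]_n.+1) : psdmx A ->
  exists (U : 'M[C]_n.+1) (lam : 'I_n.+1 -> C),
  [/\ U \is unitarymx, forall l, 0 <= lam l &
      forall k, A ^+ k = U^t* *m diag_mx (\row_l lam l ^+ k) *m U].
Proof.
move=> [hA pA]; set U := spectralmx A; set D := spectral_diag A.
have hU : U \is unitarymx by exact: spectral_unitarymx.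
have hH : A \is hermsymmx by rewrite qualifE /= expr0 scale1r hA.
have eA : A = U^t* *m diag_mx D *m U.
  by rewrite -invmx_unitary //; apply/orthomx_spectralP/hermitian_normalmx.
exists U, (fun l => D 0 l); split => // [l|k].
  have := pA (U^t* *m delta_mx l 0).
  rewrite {1}eA trmx_mul map_mxM trmxCK !mulmxA.
  rewrite -(mulmxA _ U) (unitarymxP hU) mulmx1 -(mulmxA _ U) (unitarymxP hU).
  rewrite mulmx1 trmx_delta map_delta_mx -rowE -colE !mxE eqxx mulr1n //.
elim: k => [|k IH].
  rewrite expr0; have -> : diag_mx (\row_l D 0 l ^+ 0) = 1%:M :> 'M[C]_n.+1.
    by apply/matrixP=> i j; rewrite !mxE expr0.
  by rewrite mulmx1 unitarymx_conj.
rewrite exprSr IH {1}eA -[LHS]/((_ : 'M_n.+1) *m (_ : 'M_n.+1)) !mulmxA.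
rewrite -(mulmxA _ U) (unitarymxP hU) mulmx1 -(mulmxA _ (diag_mx _) (diag_mx _)).
rewrite mulmx_diag; congr (_ *m diag_mx _ *m _).
by apply/rowP=> i; rewrite !mxE exprSr.
Qed.

(** The weights form the spectral measure of [v]: squared moduli of its coordinates in an eigenbasis
    of [A]. As [lam] is chosen before [v], traces and quadratic forms share the same eigenvalues. *)
Lemma psdmx_moments n (A : 'M[C]_n.+1) : psdmx A ->
  exists lam : 'I_n.+1 -> C,
  [/\ forall l, 0 <= lam l,
      forall k, \tr (A ^+ k) = \sum_l lam l ^+ k &
      forall v : 'cV[C]_n.+1, exists w : 'I_n.+1 -> C,
        [/\ forall l, 0 <= w l, \sum_l w l = (v^t* *m v) 0 0 &
            forall k, (v^t* *m A ^+ k *m v) 0 0 = \sum_l w l * lam l ^+ k]].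
Proof.
move=> /psdmx_spectral [U [lam [hU lam0 eA]]]; exists lam; split=> // [k|v].
  rewrite eA mxtrace_mulC mulmxA (unitarymxP hU) mul1mx mxtrace_diag.
  by apply: eq_bigr => l _; rewrite mxE.
exists (fun l => `|(U *m v) l 0| ^+ 2); split=> [l||k]; first by rewrite exprn_ge0.
  rewrite -trmxC_mul_self trmx_mul map_mxM !mulmxA -(mulmxA _ _ U).
  by rewrite unitarymx_conj ?mulmx1.
rewrite eA !mulmxA -(mulmxA _ U v).
have -> : v^t* *m U^t* = (U *m v)^t* by rewrite trmx_mul map_mxM.
rewrite mxE; apply: eq_bigr => l _; rewrite mul_mx_diag !mxE normCK.
by rewrite mulrAC [X in X * _]mulrC.
Qed.

(** The nonnegative double sum of [w i * w j * ((f i - f j) * (g i - g j))] expands to twice the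
    difference of the two sides. *)
Lemma chebyshev_sum (I : finType) (w f g : I -> C) :
  (forall i, 0 <= w i) -> \sum_i w i = 1 ->
  (forall i j, 0 <= (f i - f j) * (g i - g j)) ->
  (\sum_i w i * f i) * (\sum_i w i * g i) <= \sum_i w i * (f i * g i).
Proof.
move=> w0 w1 fg.
have : 0 <= \sum_i \sum_j w i * w j * ((f i - f j) * (g i - g j)).
  apply: sumr_ge0 => i _; apply: sumr_ge0 => j _.
  exact: mulr_ge0 (mulr_ge0 (w0 i) (w0 j)) (fg i j).
set F := \sum_i w i * f i; set G := \sum_i w i * g i; set FG := \sum_i w i * (f i * g i).
have -> : \sum_i \sum_j w i * w j * ((f i - f j) * (g i - g j)) = (FG - F * G) *+ 2.
  have e1 i : \sum_j w i * w j * ((f i - f j) * (g i - g j)) =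
     w i * (f i * g i) - w i * f i * G - w i * g i * F + w i * FG.
    rewrite -[w i * (f i * g i)]mulr1 -w1 !mulr_sumr -!sumrB -big_split /=.
    by apply: eq_bigr => j _; ring.
  rewrite (eq_bigr _ (fun i _ => e1 i)) big_split /= !sumrB -!mulr_suml w1.
  by rewrite -/F -/G -/FG; ring.
by rewrite pmulrn_lge0 // subr_ge0.
Qed.

(** Powers and shifted powers both increase on nonnegative arguments, so they are similarly ordered
    as Chebyshev's inequality requires. *)
Lemma mulr_expn_diff_ge0 (x y a : C) m j : 0 <= x -> 0 <= y -> 0 <= a ->
  0 <= (x ^+ m - y ^+ m) * ((x + a) ^+ j - (y + a) ^+ j).
Proof.
move=> x0 y0 a0; wlog le_yx : x y x0 y0 / y <= x.
  move=> H; case/orP: (real_leVge (ger0_real x0) (ger0_real y0)) => [h|h].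
    by rewrite -mulrNN !opprB H.
  exact: H.
by rewrite mulr_ge0 // subr_ge0 lerXn2r ?nnegrE ?addr_ge0 ?lerD2r.
Qed.

Section RankOneUpdate.
Variables (n : nat) (H : 'M[C]_n.+1) (v : 'cV[C]_n.+1) (x : C).
Variables (lam w : 'I_n.+1 -> C).
Hypotheses (x0 : 0 <= x) (lam0 : forall l, 0 <= lam l) (w0 : forall l, 0 <= w l).
Hypothesis momentE :
  forall k, (v^t* *m H ^+ k *m v) 0 0 = \sum_l w l * lam l ^+ k.

Let A := H + x *: (v *m v^t*).
(** [c] and [g] interpolate between powers of [H] ([j = 0]) and of [A] ([m = 0]). Their recursions
    exchange one factor [A] for [H] plus a correction, which is a product of scalars or a scalar
    moment because [v v^*] has rank one. *)
Let c m j := (v^t* *m H ^+ m *m A ^+ j *m v) 0 0.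
Let g m j := \tr (A ^+ j *m H ^+ m).

Let mixed_moment_rec m j : c m j.+1 = c m.+1 j + x * (c m 0 * c 0 j).
Proof.
rewrite /c exprS -[A * A ^+ j]/(A *m A ^+ j) {1}/A mulmxDl mulmxDr mulmxDl mxE.
congr (_ + _).
  by rewrite exprSr -[H ^+ m * H]/(H ^+ m *m H) !mulmxA.
rewrite -scalemxAl -scalemxAr -scalemxAl mxE !expr0 !mulmx1; congr (_ * _).
have -> : v^t* *m H ^+ m *m (v *m v^t* *m A ^+ j) *m v =
          (v^t* *m H ^+ m *m v) *m (v^t* *m A ^+ j *m v) by rewrite !mulmxA.
by rewrite [LHS]mxE big_ord1.
Qed.

Let mixed_trace_rec m j : g m j.+1 = g m.+1 j + x * c m j.
Proof.
rewrite /g exprSr -[A ^+ j * A]/(A ^+ j *m A) {2}/A mulmxDr mulmxDl mxtraceD.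
congr (_ + _); first by rewrite exprS -[H * H ^+ m]/(H *m H ^+ m) mulmxA.
rewrite -scalemxAr -scalemxAl mxtraceZ /c; congr (_ * _).
have -> : A ^+ j *m (v *m v^t*) *m H ^+ m =
          (A ^+ j *m v) *m (v^t* *m H ^+ m) by rewrite !mulmxA.
by rewrite mxtrace_mulC mulmxA /mxtrace big_ord1.
Qed.

Let momentE0 m : c m 0 = \sum_l w l * lam l ^+ m.
Proof. by rewrite /c expr0 mulmx1 momentE. Qed.

Let moment_ge0 m : 0 <= c m 0.
Proof. by rewrite momentE0 sumr_ge0 // => l _; rewrite mulr_ge0 ?exprn_ge0. Qed.

(** Dropping the nonnegative products in the recursion gives [c m j >= c (m + j) 0]. Each of the
    [k.+1] exchanges of [A] for [H] then contributes at least [x * c k 0]. *)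
Lemma trace_rank1_update_ge k :
  x * (\sum_l w l * lam l ^+ k) *+ k.+1 <= \tr (A ^+ k.+1) - \tr (H ^+ k.+1).
Proof.
have c_lo j m : c (m + j)%N 0 <= c m j.
  elim: j m => [|j IH] m; first by rewrite addn0.
  rewrite mixed_moment_rec -addSnnS (le_trans (IH _)) // lerDl !mulr_ge0 //.
  exact: le_trans (IH _).
(* For [j = 0] the predecessor is harmless, because its term is taken zero times. *)
have lo j m : g (m + j)%N 0 + x * c (m + j).-1 0 *+ j <= g m j.
  elim: j m => [|j IH] m; first by rewrite addn0 mulr0n addr0.
  rewrite mixed_trace_rec -addSnnS mulrSr addrA lerD //.
  by rewrite ler_wpM2l // c_lo.
have := lo k.+1 0%N; rewrite add0n /= momentE0 /g !expr0 mul1mx mulmx1.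
by rewrite lerBrDl.
Qed.

(** Each mixed moment is at most its commuting analogue, in which [A] acts as [lam l + x] on the
    spectral measure of [v]. *)
Lemma trace_rank1_update_le k : \sum_l w l = 1 ->
  \tr (A ^+ k) - \tr (H ^+ k) <= \sum_l w l * ((lam l + x) ^+ k - lam l ^+ k).
Proof.
move=> w1.
have c_up j m : c m j <= \sum_l w l * (lam l ^+ m * (lam l + x) ^+ j).
  elim: j m => [|j IH] m.
    by rewrite momentE0; apply: ler_sum => l _; rewrite expr0 mulr1.
  rewrite mixed_moment_rec.
  (* Chebyshev's inequality merges the product of two moments into one, so that the recursion
     closes. *)
  have cheb : c m 0 * c 0 j <= \sum_l w l * (lam l ^+ m * (lam l + x) ^+ j).
    apply: (@le_trans _ _ ((\sum_l w l * lam l ^+ m) *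
                           (\sum_l w l * (lam l + x) ^+ j))).
      rewrite momentE0 ler_wpM2l //; first by rewrite -momentE0.
      apply: le_trans (IH 0%N) _.
      by apply: ler_sum => l _; rewrite expr0 mul1r.
    by apply: chebyshev_sum => // i k'; apply: mulr_expn_diff_ge0.
  apply: (le_trans (lerD (IH _) (ler_wpM2l x0 cheb))).
  rewrite mulr_sumr -big_split /= le_eqVlt; apply/predU1P; left.
  by apply: eq_bigr => l _; rewrite !exprS; ring.
have up j m : g m j <= g (m + j)%N 0 +
    \sum_l w l * (lam l ^+ m * ((lam l + x) ^+ j - lam l ^+ j)).
  elim: j m => [|j IH] m.
    by rewrite addn0 big1 ?addr0 // => l _; rewrite !expr0 subrr !mulr0.
  rewrite mixed_trace_rec -addSnnS.
  apply: (le_trans (lerD (IH _) (ler_wpM2l x0 (c_up _ _)))).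
  rewrite -addrA lerD2l mulr_sumr -big_split /= le_eqVlt; apply/predU1P; left.
  by apply: eq_bigr => l _; rewrite !exprS; ring.
have := up k 0%N; rewrite add0n /g !expr0 mul1mx mulmx1 => up0.
rewrite lerBlDl (le_trans up0) // lerD2l.
by apply: ler_sum => l _; rewrite expr0 mul1r.
Qed.

End RankOneUpdate.
End PositiveSemidefinite.

(** * Truncated exponentials *)

Definition texp (F : fieldType) N (x : F) := \sum_(k < N) x ^+ k / k`!%:R.

Section TruncatedExponential.
Variable F : numFieldType.
Implicit Types x y : F.

(* [172 / 100] bounds [e - 1] from above; its double is the 3.44 of the theorem. *)
Lemma sum_inv_fact_le N : \sum_(i < N) (i.+1`!%:R)^-1 <= 172 / 100 :> F.
Proof.
have fact_ge0 m : 0 <= (m`!%:R)^-1 :> F by rewrite invr_ge0 ler0n.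
pose S m : F := \sum_(i < m) (i.+1`!%:R)^-1.
have S_mono m k : S m <= S (m + k)%N.
  elim: k => [|k IH]; first by rewrite addn0.
  by rewrite (le_trans IH) // /S addnS big_ord_recr /= lerDl.
apply: le_trans (S_mono N 5%N) _; rewrite addnC.
(* With this remainder the bound is nonincreasing in [N]; at [N = 0] it falls short of [172 / 100]
   by [2 / 3600]. *)
apply: (@le_trans _ _ (S (5 + N)%N + 2 / (5 + N).+1`!%:R)).
  by rewrite lerDl mulr_ge0.
elim: N => [|N IH].
  rewrite addn0 /S !big_ord_recr big_ord0 /= add0r.
  have -> : 1`! = 1%N by []. have -> : 2`! = 2%N by [].
  have -> : 3`! = 6%N by []. have -> : 4`! = 24%N by [].
  have -> : 5`! = 120%N by []. have -> : 6`! = (6 * 120)%N by [].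
  rewrite -subr_ge0 (_ : _ - _ = 2 / 3600); first by rewrite mulr_ge0 ?invr_ge0.
  by field.
apply: le_trans IH; rewrite addnS /S big_ord_recr /= -addrA lerD2l.
rewrite [(_.+2)`!]factS natrM invfM mulrA.
have h : 2 / (5 + N).+2%:R <= 1 :> F by rewrite ler_pdivrMr ?mul1r ?ler_nat.
move: (_ / (5 + N).+2%:R) h (fact_ge0 (5 + N).+1) => q h f0.
by rewrite mulr_natl mulr2n lerD2l ler_piMl.
Qed.

Lemma exprDn_fact x y k :
  (x + y) ^+ k / k`!%:R = \sum_(i < k.+1) x ^+ (k - i) / (k - i)`!%:R * (y ^+ i / i`!%:R).
Proof.
have nz m : m`!%:R != 0 :> F by rewrite pnatr_eq0 -lt0n fact_gt0.
rewrite exprDn mulr_suml; apply: eq_bigr => i _.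
have ik : (i <= k)%N by exact: leq_ord.
rewrite -[in LHS](bin_fact ik) !natrM.
have cnz : 'C(k, i)%:R != 0 :> F by rewrite pnatr_eq0 -lt0n bin_gt0.
rewrite -mulr_natr; field; rewrite cnz !nz //.
Qed.

Lemma sum_convolution (a c : nat -> F) N :
  \sum_(k < N) \sum_(i < k.+1) a (k - i)%N * c i =
  \sum_(i < N) c i * \sum_(m < N - i) a m.
Proof.
elim: N => [|N IH]; first by rewrite !big_ord0.
rewrite big_ord_recr /= IH [in LHS]big_ord_recr /= [in RHS]big_ord_recr /=.
rewrite addrA -big_split /= subnn subSnn big_ord1 [c N * _]mulrC; congr (_ + _).
apply: eq_bigr => i _; rewrite subSn ?(ltnW (ltn_ord i)) // big_ord_recr /=.
by rewrite mulrDr [a _ * _]mulrC.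
Qed.

Lemma ler_sum_ord_widen (a : nat -> F) m N : (forall i, 0 <= a i) -> (m <= N)%N ->
  \sum_(i < m) a i <= \sum_(i < N) a i.
Proof.
move=> a0 mN; rewrite (big_ord_widen _ a mN) big_mkcond /=.
by apply: ler_sum => i _; case: ifP.
Qed.

(** The constant term in [y] cancels, leaving a Cauchy product of [x^m / m!] with
    [y^(i+1) / (i+1)!]. For [y <= 1] the latter is at most [y / (i+1)!], and these reciprocals are
    summable to at most [172 / 100]. *)
Lemma texp_increment_le N x y : 0 <= x -> 0 <= y -> y <= 1 ->
  texp N.+1 (x + y) - texp N.+1 x <= 172 / 100 * y * texp N x.
Proof.
move=> x0 y0 y1.
pose a m := x ^+ m / m`!%:R; pose c i := y ^+ i.+1 / i.+1`!%:R.
have a0 m : 0 <= a m by rewrite mulr_ge0 ?exprn_ge0 ?invr_ge0 ?ler0n.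
have c0 m : 0 <= c m by rewrite mulr_ge0 ?exprn_ge0 ?invr_ge0 ?ler0n.
have -> : texp N.+1 (x + y) - texp N.+1 x =
          \sum_(k < N) \sum_(i < k.+1) a (k - i)%N * c i.
  rewrite /texp -sumrB big_ord_recl /= !expr0 subrr add0r; apply: eq_bigr => k _.
  rewrite /bump leq0n add1n exprDn_fact big_ord_recl /= subn0 expr0 fact0 divr1 mulr1.
  by rewrite addrC addKr; apply: eq_bigr => i _; rewrite /bump leq0n add1n subSS.
rewrite sum_convolution.
apply: (@le_trans _ _ (\sum_(i < N) (y * (i.+1`!%:R)^-1 * texp N x))).
  apply: ler_sum => i _; apply: ler_pM => //; first by apply: sumr_ge0 => m _; exact: a0.
    rewrite /c exprS -mulrA ler_wpM2l // ler_piMl ?invr_ge0 ?ler0n //.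
    by rewrite exprn_ile1.
  exact: ler_sum_ord_widen (leq_subr _ _).
rewrite -mulr_suml -mulr_sumr [172 / 100 * y]mulrC.
apply: ler_wpM2r; first by apply: sumr_ge0 => m _; exact: a0.
by rewrite ler_wpM2l // sum_inv_fact_le.
Qed.

End TruncatedExponential.

Section TraceExponential.
Local Open Scope sesquilinear_scope.
Variable C : numClosedFieldType.

Definition trexp n N (A : 'M[C]_n.+1) := \sum_(k < N) \tr (A ^+ k) / k`!%:R.

Lemma trexp_scalar n N (a : C) : trexp N (a%:M : 'M[C]_n.+1) = n.+1%:R * texp N a.
Proof.
rewrite /trexp /texp mulr_sumr; apply: eq_bigr => k _.
have -> : (a%:M : 'M[C]_n.+1) ^+ k = (a ^+ k)%:M by rewrite -rmorphXn.
by rewrite mxtrace_scalar mulrA mulr_natl.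
Qed.

(* Applied with [p] the probability that an index is put in a given block: it
   trades the random rank-one update for a deterministic one. *)
Lemma trexp_rank1_mix n N (H : 'M[C]_n.+1) (v : 'cV[C]_n.+1) (a p : C) :
  psdmx H -> (v^t* *m v) 0 0 = 1 -> 0 <= a -> a <= 1 -> 0 <= p ->
  (1 - p) * trexp N.+1 H + p * trexp N.+1 (H + a *: (v *m v^t*)) <=
  trexp N.+1 (H + (p * (172 / 100) * a) *: (v *m v^t*)).
Proof.
move=> psdH v1 a0 a1 p0.
have [lam [lam0 _ /(_ v) [w [w0 w1 hw]]]] := psdmx_moments psdH.
rewrite v1 in w1.
(* With this [b], the lower bound for the update by [b] equals [p] times the upper bound for the
   update by [a]. *)
set b := p * _ * a.
have b0 : 0 <= b by rewrite !mulr_ge0 ?invr_ge0.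
have up : trexp N.+1 (H + a *: (v *m v^t*)) - trexp N.+1 H <=
          172 / 100 * a * \sum_l w l * texp N (lam l).
  apply: (@le_trans _ _ (\sum_l w l * (texp N.+1 (lam l + a) - texp N.+1 (lam l)))).
    rewrite /trexp /texp -sumrB.
    under [leRHS]eq_bigr => l _ do rewrite -sumrB mulr_sumr.
    rewrite exchange_big /=; apply: ler_sum => k _; rewrite -mulrBl.
    under eq_bigr => l _ do rewrite -mulrBl mulrA.
    rewrite -mulr_suml ler_wpM2r ?invr_ge0 ?ler0n //.
    exact: trace_rank1_update_le.
  rewrite mulr_sumr; apply: ler_sum => l _; rewrite mulrCA ler_wpM2l //.
  exact: texp_increment_le.
have lo : b * (\sum_l w l * texp N (lam l)) <=
          trexp N.+1 (H + b *: (v *m v^t*)) - trexp N.+1 H.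
  (* The order-zero terms cancel; in the others [k.+1] cancels against the factorial of [k.+1],
     which turns [N.+1] into [N]. *)
  rewrite /trexp -sumrB [leRHS]big_ord_recl /= !expr0 subrr add0r /texp.
  under eq_bigr => l _ do rewrite mulr_sumr.
  rewrite exchange_big /= mulr_sumr; apply: ler_sum => k _.
  rewrite /bump leq0n add1n -mulrBl ler_pdivlMr ?ltr0n ?fact_gt0 //.
  have := trace_rank1_update_ge b0 lam0 w0 hw k; apply: le_trans.
  under eq_bigr => l _ do rewrite mulrA.
  rewrite -mulr_suml factS natrM [_.+1%:R * _]mulrC !mulrA.
  by rewrite mulfVK ?mulr_natr // pnatr_eq0 -lt0n fact_gt0.
have := ler_wpM2l p0 up.
rewrite [X in _ <= X]mulrA [p * (_ * a)]mulrA -/b => /le_trans/(_ lo).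
rewrite lerBrDr; congr (_ <= _); ring.
Qed.

End TraceExponential.

(** * Averaging over random assignments, one index at a time *)

Definition ffun_cons n (T : Type) (a : T) (g : {ffun 'I_n -> T}) : {ffun 'I_n.+1 -> T} :=
  [ffun i => oapp g a (unlift ord0 i)].

Lemma ffun_cons0 n (T : Type) (a : T) (g : {ffun 'I_n -> T}) : ffun_cons a g ord0 = a.
Proof. by rewrite ffunE unlift_none. Qed.

Lemma ffun_consS n (T : Type) (a : T) (g : {ffun 'I_n -> T}) i :
  ffun_cons a g (lift ord0 i) = g i.
Proof. by rewrite ffunE liftK. Qed.

Lemma sum_ffun_recl (V : nmodType) n (T : finType) (F : {ffun 'I_n.+1 -> T} -> V) :
  \sum_f F f = \sum_a \sum_g F (ffun_cons a g).
Proof.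
rewrite pair_big /= (reindex (fun u : T * {ffun 'I_n -> T} => ffun_cons u.1 u.2)) //=.
exists (fun f => (f ord0, [ffun i => f (lift ord0 i)])) => [[a g] _|f _] /=.
  rewrite ffun_cons0; congr (_, _).
  by apply/ffunP => i; rewrite ffunE ffun_consS.
apply/ffunP => i; case: (unliftP ord0 i) => [j|] ->.
  by rewrite ffun_consS ffunE.
by rewrite ffun_cons0.
Qed.

Section AverageTraceExponential.
Local Open Scope sesquilinear_scope.

(** Induction on [n] with [H] general: [H] absorbs the outcome of the first index, the induction
    hypothesis replaces the other summands by scaled means, and [trexp_rank1_mix] with [p = 1 / r]
    then treats the first one. *)
Lemma sum_trexp_le (C : numClosedFieldType) d n N r (b : 'I_r)
    (H : 'M[C]_d.+1) (v : 'I_n -> 'cV[C]_d.+1) (a : 'I_n -> C) :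
  psdmx H -> (forall i, ((v i)^t* *m v i) 0 0 = 1) ->
  (forall i, 0 <= a i) -> (forall i, a i <= 1) ->
  \sum_(f : {ffun 'I_n -> 'I_r})
     trexp N.+1 (H + \sum_(i | f i == b) a i *: (v i *m (v i)^t*)) <=
  (r ^ n)%:R *
  trexp N.+1 (H + \sum_i (r%:R^-1 * (172 / 100) * a i) *: (v i *m (v i)^t*)).
Proof.
have r_gt0 : (0 < r)%N by apply: leq_ltn_trans (ltn_ord b).
elim: n H v a => [|n IH] H v a psdH v1 a0 a1.
  rewrite expn0 mul1r big_ord0 addr0.
  rewrite (big_pred1 [ffun i : 'I_0 => b]) => [|f]; last first.
    by apply/esym/eqP/ffunP => -[].
  by rewrite big1 ?addr0 // => -[].
pose X i := a i *: (v i *m (v i)^t*).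
have psdX i : psdmx (X i) by exact: psdmx_scale (psdmx_outer _).
set q := r%:R^-1 * (172 / 100).
have q0 : 0 <= q by rewrite !mulr_ge0 ?invr_ge0 ?ler0n.
pose S := \sum_(i < n) (q * a (lift ord0 i)) *: (v (lift ord0 i) *m (v (lift ord0 i))^t*).
have psdS : psdmx S.
  by apply: psdmx_sum => i _; apply: psdmx_scale (psdmx_outer _); rewrite mulr_ge0.
rewrite sum_ffun_recl.
apply: (@le_trans _ _ (\sum_(c < r) (r ^ n)%:R *
    trexp N.+1 (H + (if c == b then X ord0 else 0) + S))).
  apply: ler_sum => c _.
  have psdc : psdmx (H + (if c == b then X ord0 else 0)).
    by apply: psdmx_add => //; case: ifP => _ //; exact: psdmx0.
  apply: le_trans (IH _ (fun i => v (lift ord0 i)) (fun i => a (lift ord0 i)) psdc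
    (fun i => v1 _) (fun i => a0 _) (fun i => a1 _)).
  rewrite le_eqVlt; apply/predU1P; left; apply: eq_bigr => g _; congr trexp.
  rewrite -addrA; congr (_ + _); rewrite big_mkcond big_ord_recl /= ffun_cons0.
  congr (_ + _); rewrite [RHS]big_mkcond; apply: eq_bigr => i _.
  by rewrite ffun_consS.
rewrite -mulr_sumr expnSr natrM -mulrA ler_wpM2l ?ler0n //.
(* Of the [r] values of the first index only [b] adds [X ord0]; the other [r - 1] leave [H + S]. *)
rewrite (bigD1 b) //= eqxx.
rewrite (eq_bigr (fun=> trexp N.+1 (H + S))) => [|c /negPf ->]; last by rewrite addr0.
rewrite sumr_const cardC1 card_ord.
have := trexp_rank1_mix N (psdmx_add psdH psdS) (v1 ord0) (a0 ord0) (a1 ord0)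
  (_ : 0 <= r%:R^-1).
move=> /(_ ltac:(by rewrite invr_ge0 ler0n)) /(ler_wpM2l (ler0n C r)).
have -> : H + S + (r%:R^-1 * (172 / 100) * a ord0) *: (v ord0 *m (v ord0)^t*) =
   H + \sum_i (q * a i) *: (v i *m (v i)^t*).
  by rewrite big_ord_recl addrA addrAC.
apply: le_trans; rewrite -[X ord0]/(a ord0 *: _) [H + _ + S]addrAC.
have rnz : r%:R != 0 :> C by rewrite pnatr_eq0 -lt0n.
rewrite mulrDr !mulrA divff // mul1r mulrBr mulr1 divff //.
by rewrite addrC -[in leLHS]mulr_natl -subn1 natrB.
Qed.

End AverageTraceExponential.

(** * Operator norm and real exponential *)

Section Exponential.
Local Open Scope classical_set_scope.
Variable R : realType.
Implicit Types x : R.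

Lemma texp_cvg x : (fun N => texp N x) @ \oo --> expR x.
Proof.
have -> : (fun N => texp N x) = series (exp_coeff x).
  by apply/funext => N; rewrite /series /texp /= big_mkord.
exact: is_cvg_series_exp_coeff.
Qed.

Lemma texp_le_expR N x : 0 <= x -> texp N x <= expR x.
Proof.
move=> x0; have -> : texp N x = series (exp_coeff x) N.
  by rewrite /series /texp /= big_mkord.
apply: nondecreasing_cvgn_le; last exact: is_cvg_series_exp_coeff.
apply: nondecreasing_series => i _ _; exact: exp_coeff_ge0.
Qed.

Lemma sum_expR_le (I : finType) (x : I -> R) (B : R) :
  (forall N, \sum_i texp N.+1 (x i) <= B) -> \sum_i expR (x i) <= B.
Proof.
move=> hB.
have cv : (fun N => \sum_i texp N.+1 (x i)) @ \oo --> \sum_i expR (x i).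
  apply: cvg_big => [|i _]; first exact: add_continuous.
  by have := @texp_cvg (x i); rewrite -cvg_shiftS.
apply: (cvgr_to_le cv).
by apply: nearW => N; exact: hB.
Qed.

(** The constant is [172 / 100 - 1], a bound for the sum of the reciprocals of [(k+2)!]. *)
Lemma expR_le_quadratic x : 0 <= x -> x <= 1 -> expR x <= 1 + x + 72 / 100 * x ^+ 2.
Proof.
move=> x0 x1; apply: (cvgr_to_le (@texp_cvg x)); apply: nearW => N.
have a0 m : 0 <= x ^+ m / m`!%:R :> R by rewrite mulr_ge0 ?exprn_ge0 ?invr_ge0.
apply: le_trans (ler_sum_ord_widen a0 (leqW (leqnSn N))) _.
rewrite !big_ord_recl /= expr0 expr1 !divr1 addrA lerD2l.
apply: (@le_trans _ _ (x ^+ 2 * \sum_(k < N) (k.+2`!%:R)^-1)).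
  rewrite mulr_sumr; apply: ler_sum => k _; rewrite /bump !leq0n !add1n.
  rewrite ler_wpM2r ?invr_ge0 // -[k.+2]addn2 exprD ler_piMl ?exprn_ge0 //.
  by rewrite exprn_ile1.
rewrite mulrC ler_wpM2r ?exprn_ge0 //.
have := sum_inv_fact_le R N.+1; rewrite big_ord_recl /= invr1.
under eq_bigr => i _ do rewrite /bump leq0n add1n.
lra.
Qed.

(** Jensen's inequality from the tangent to the exponential at the mean [m], whose linear part sums
    to zero. *)
Lemma jensen_expR (I : finType) (x : I -> R) (B : R) : (0 < #|I|)%N -> 0 < B ->
  \sum_i expR (x i) <= #|I|%:R * B -> \sum_i x i <= #|I|%:R * ln B.
Proof.
move=> I0 B0 h; have I0' : 0 < #|I|%:R :> R by rewrite ltr0n.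
set m := (\sum_i x i) / #|I|%:R.
have mE : \sum_i x i = #|I|%:R * m by rewrite mulrC divfK // gt_eqF.
rewrite mE ler_pM2l // -ler_expR lnK // -(ler_pM2l I0').
apply: le_trans h.
apply: (@le_trans _ _ (\sum_i expR m * (1 + (x i - m)))).
  rewrite -mulr_sumr big_split sumrB /= !sumr_const mE.
  by rewrite [#|I|%:R * m]mulr_natl subrr addr0 mulrC.
apply: ler_sum => i _; rewrite -[x i in leRHS](subrK m) [_ + m]addrC expRD.
by rewrite ler_wpM2l ?expR_ge0 // expR_ge1Dx.
Qed.
End Exponential.

Section OperatorNorm.
Local Open Scope sesquilinear_scope.
Local Open Scope complex_scope.
Local Open Scope classical_set_scope.
Variable R : realType.
Local Notation C := (complex R).

Lemma adjmxE m n (A : 'M[C]_(m, n)) : adjmx A = A^t*.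
Proof. by apply/matrixP => i j; rewrite !mxE; case: (A j i). Qed.

Lemma vnorm2E d (v : 'cV[C]_d) : (vnorm2 v)%:C = (v^t* *m v) 0 0.
Proof.
rewrite trmxC_mul_self /vnorm2 rmorph_sum; apply: eq_bigr => i _.
exact: add_Re2_Im2.
Qed.

Lemma texpC N (x : R) : (texp N x)%:C = texp N x%:C.
Proof.
rewrite /texp rmorph_sum; apply: eq_bigr => k _.
by rewrite rmorphM rmorphXn fmorphV rmorph_nat.
Qed.

Variables (d : nat) (A : 'M[C]_d.+1).
Hypothesis psdA : psdmx A.

Lemma vnorm2_mulE (v : 'cV[C]_d.+1) :
  (vnorm2 (A *m v))%:C = (v^t* *m A ^+ 2 *m v) 0 0.
Proof.
rewrite vnorm2E trmx_mul map_mxM (proj1 psdA) expr2.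
by rewrite -[A * A]/(A *m A) !mulmxA.
Qed.

(** The witness is the largest eigenvalue; its powers are bounded by traces because the other
    eigenvalues are nonnegative. *)
Lemma psdmx_top_eigenvalue : exists2 m : R,
  [/\ 0 <= m & forall v, vnorm2 v = 1 -> Num.sqrt (vnorm2 (A *m v)) <= m] &
  forall k, (m ^+ k)%:C <= \tr (A ^+ k).
Proof.
have [lam [lam0 trA hA]] := psdmx_moments psdA.
pose mu l := complex.Re (lam l).
have lamE l : lam l = (mu l)%:C by rewrite RRe_real // ger0_real.
have mu0 l : 0 <= mu l by rewrite -lecR -lamE.
pose l0 := [arg max_(l > ord0) mu l]%O.
have l0P l : mu l <= mu l0 by rewrite /l0; case: arg_maxP => // i _; apply.
exists (mu l0) => [|k]; last first.
  rewrite trA (bigD1 l0) //= lamE rmorphXn lerDl sumr_ge0 // => l _.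
  by rewrite exprn_ge0.
split=> // v v1; have [w [w0 w1 hw]] := hA v.
rewrite -vnorm2E v1 rmorph1 in w1.
rewrite -[leRHS]ger0_norm // -sqrtr_sqr ler_wsqrtr // -lecR vnorm2_mulE hw.
rewrite -[leRHS]mul1r -w1 mulr_suml; apply: ler_sum => l _.
by rewrite ler_wpM2l // lamE -rmorphXn lecR lerXn2r ?nnegrE.
Qed.

(** Nonemptiness and the upper bound above keep [sup] from taking its default value. *)
Lemma opnorm_set_nonempty :
  [set Num.sqrt (vnorm2 (A *m v)) | v in [set v : 'cV[C]_d.+1 | vnorm2 v = 1]] !=set0.
Proof.
exists (Num.sqrt (vnorm2 (A *m delta_mx ord0 0))); exists (delta_mx ord0 0) => //=.
apply: complexI; rewrite vnorm2E trmx_delta map_delta_mx mul_delta_mx mxE !eqxx.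
by [].
Qed.

Lemma sqrt_vnorm2_le_opnorm v : vnorm2 v = 1 ->
  Num.sqrt (vnorm2 (A *m v)) <= opnorm A.
Proof.
move=> v1; have [m [_ ub] _] := psdmx_top_eigenvalue.
apply: ub_le_sup; last by exists v.
by exists m => _ [u u1 <-]; exact: ub.
Qed.

Lemma opnorm_ge0 : 0 <= opnorm A.
Proof.
have [_ [v v1 _]] := opnorm_set_nonempty.
exact: le_trans (sqrtr_ge0 _) (sqrt_vnorm2_le_opnorm v1).
Qed.

(** Termwise, the norm is at most the top eigenvalue, whose powers are at most the traces. *)
Lemma texp_opnorm_le N (c : R) : 0 <= c ->
  (texp N (c * opnorm A))%:C <= trexp N (c%:C *: A).
Proof.
move=> c0; have [m [m0 ub] trA] := psdmx_top_eigenvalue.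
have le_m : opnorm A <= m.
  by apply: ge_sup; [exact: opnorm_set_nonempty | move=> _ [u u1 <-]; exact: ub].
rewrite texpC /trexp; apply: ler_sum => k _.
rewrite ler_wpM2r ?invr_ge0 ?ler0n // exprZn mxtraceZ.
apply: le_trans (_ : (c ^+ k * m ^+ k)%:C <= _).
  rewrite -rmorphXn /= lecR exprMn ler_wpM2l ?exprn_ge0 //.
  by rewrite lerXn2r ?nnegrE ?opnorm_ge0.
have ck : 0 <= (c%:C : C) ^+ k by rewrite exprn_ge0 // ler0c.
by rewrite rmorphM rmorphXn; exact: (ler_wpM2l ck (trA k)).
Qed.

(** Cauchy-Schwarz in spectral form: the square of [v^* A v] is at most [v^* A^2 v], by Chebyshev's
    inequality with both functions equal to [lam]. *)
Lemma quad_le_opnorm v : vnorm2 v = 1 ->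
  complex.Re ((v^t* *m A *m v) 0 0) <= opnorm A.
Proof.
move=> v1; apply: le_trans (sqrt_vnorm2_le_opnorm v1).
have [lam [lam0 _ /(_ v) [w [w0 w1 hw]]]] := psdmx_moments psdA.
rewrite -vnorm2E v1 rmorph1 in w1.
set z := (v^t* *m A *m v) 0 0.
have z0 : 0 <= z by exact: (proj2 psdA).
have zE : z = (complex.Re z)%:C by rewrite RRe_real // ger0_real.
have rez0 : 0 <= complex.Re z by rewrite -lecR -zE.
rewrite -[leLHS]ger0_norm // -sqrtr_sqr ler_wsqrtr // -lecR vnorm2_mulE hw.
rewrite rmorphXn /= -zE expr2.
have -> : z = \sum_l w l * lam l by rewrite /z -[A]expr1 hw.
apply: le_trans (chebyshev_sum w0 w1 _) _ => [i j|].
  by have := mulr_expn_diff_ge0 1 1 (lam0 i) (lam0 j) (lexx 0); rewrite !addr0 !expr1.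
by apply: ler_sum => l _; rewrite expr2.
Qed.

End OperatorNorm.

(** * Random partitions *)

Section Counting.
Variable R : realType.

Lemma natr_card_set (T : finType) (P : pred T) :
  #|[set x | P x]|%:R = \sum_x (P x)%:R :> R.
Proof.
rewrite -sum1_card natr_sum big_mkcond /=; apply: eq_bigr => x _.
by rewrite inE; case: (P x).
Qed.

(** Markov's inequality for counting measure. Probabilities are handled as cardinalities until the
    final division by [r ^ n]. *)
Lemma card_markov (T : finType) (x : T -> R) (t : R) : (forall i, 0 <= x i) ->
  #|[set i | t < x i]|%:R * t <= \sum_i x i.
Proof.
move=> x0; rewrite natr_card_set mulr_suml; apply: ler_sum => i _.
by case: ltP => [/ltW|] h; rewrite ?mul1r ?mul0r.
Qed.

(** Moment generating function of a block size: by independence the sum over assignments factors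
    over the indices. *)
Lemma sum_expR_card n r (b : 'I_r) (t : R) :
  \sum_(f : {ffun 'I_n -> 'I_r}) expR (t * #|[set i | f i == b]|%:R) =
  (r%:R + (expR t - 1)) ^+ n.
Proof.
transitivity (\prod_(i < n) \sum_(c < r) (if c == b then expR t else 1)).
  rewrite bigA_distr_bigA /=; apply: eq_bigr => f _.
  rewrite natr_card_set mulr_sumr expR_sum; apply: eq_bigr => i _.
  by case: eqP => _; rewrite ?mulr1 // mulr0 expR0.
rewrite prodr_const card_ord; congr (_ ^+ _).
have -> : \sum_(c < r) (if c == b then expR t else 1) =
          \sum_(c < r) (1 + (if c == b then expR t - 1 else 0)).
  by apply: eq_bigr => c _; case: ifP => _; rewrite ?addr0 // addrC subrK.
by rewrite big_split /= sumr_const card_ord -big_mkcond big_pred1_eq.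
Qed.

(** Chernoff bound, with [mu] an upper bound for the mean block size [n / r]. *)
Lemma block_size_tail n r (b : 'I_r) (mu delta : R) :
  n%:R <= mu * r%:R -> 0 < delta -> delta <= 1 ->
  #|[set f : {ffun 'I_n -> 'I_r} |
      mu * (1 + delta) < #|[set i | f i == b]|%:R]|%:R <=
  (r ^ n)%:R * expR (- (mu * delta ^+ 2 / 3)).
Proof.
(* For this [t] the exponent is at most [mu * delta ^+ 2] times [0.72 * 4 / 9 - 2 / 3], which is
   below [- 1 / 3]. *)
move=> n_le d0 d1; pose t := 2 / 3 * delta.
have t0 : 0 < t by rewrite /t; lra.
have r0 : 0 < r%:R :> R by rewrite ltr0n; apply: leq_ltn_trans (ltn_ord b).
have mu0 : 0 <= mu by rewrite -(pmulr_lge0 _ r0) (le_trans _ n_le).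
have := @card_markov {ffun 'I_n -> 'I_r} _ (expR (t * (mu * (1 + delta))))
  (fun f => expR_ge0 (t * #|[set i | f i == b]|%:R)).
rewrite sum_expR_card -ler_pdivlMr ?expR_gt0 // => tail.
apply: (@le_trans _ _ #|[set f : {ffun 'I_n -> 'I_r} |
   expR (t * (mu * (1 + delta))) < expR (t * #|[set i | f i == b]|%:R)]|%:R).
  rewrite !natr_card_set; apply: ler_sum => f _; rewrite ler_nat ltr_expR.
  by rewrite ltr_pM2l.
apply: (le_trans tail).
have quad := expR_le_quadratic (ltW t0) (_ : t <= 1).
have {}quad : expR t <= 1 + t + 72 / 100 * t ^+ 2 by apply: quad; rewrite /t; lra.
have -> : r%:R + (expR t - 1) = r%:R * (1 + (expR t - 1) / r%:R).
  by field; rewrite gt_eqF.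
rewrite exprMn natrX -[leLHS]mulrA ler_wpM2l ?exprn_ge0 ?ler0n //.
have et1 : 0 <= expR t - 1 by rewrite subr_ge0 ltW // expR_gt1.
apply: (@le_trans _ _ (expR (mu * (expR t - 1)) / expR (t * (mu * (1 + delta))))).
  rewrite ler_wpM2r ?invr_ge0 ?expR_ge0 //.
  apply: (@le_trans _ _ (expR ((expR t - 1) / r%:R) ^+ n)).
    by rewrite lerXn2r ?nnegrE ?expR_ge0 ?expR_ge1Dx // addr_ge0 ?divr_ge0.
  rewrite -expRM_natr ler_expR mulrAC ler_pdivrMr // mulrAC [_ * n%:R]mulrC.
  by rewrite ler_wpM2r.
rewrite -expRB ler_expR.
have : mu * (expR t - 1) <= mu * (t + 72 / 100 * t ^+ 2) by rewrite ler_wpM2l //; lra.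
have : 0 <= mu * delta ^+ 2 by rewrite mulr_ge0 // exprn_ge0 // ltW.
move: (expR t) => e; rewrite /t; nra.
Qed.
End Counting.

(** * Norms of the blocks of a random partition *)

Section Blocks.
Variables (R : realType) (d n r : nat).
Variables (alpha : 'I_n -> R) (psi : 'I_n -> 'cV[complex R]_d.+1).
Local Open Scope sesquilinear_scope.
Local Open Scope complex_scope.
Local Notation C := (complex R).
Local Notation D := (d.+1%:R : R).
Hypothesis psi1 : forall i, vnorm2 (psi i) = 1.
Hypothesis alpha_ge0 : forall i, 0 <= alpha i.
Hypothesis alpha_le : forall i, alpha i <= 1 / D.
Hypothesis sum1 : \sum_i (alpha i)%:C *: (psi i *m (psi i)^t*) = 1%:M.

Let block (f : {ffun 'I_n -> 'I_r}) b : 'M[C]_d.+1 :=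
  \sum_(i | f i == b) (alpha i)%:C *: (psi i *m (psi i)^t*).

Lemma psdmx_block f b : psdmx (block f b).
Proof.
by apply: psdmx_sum => i _; apply: psdmx_scale (psdmx_outer _); rewrite ler0c.
Qed.

(** At any unit vector the quadratic forms of the blocks add up to 1. The bound provides the
    positivity needed to invert the sum in [qval]. *)
Lemma sum_opnorm_block_ge1 f : 1 <= \sum_b opnorm (block f b).
Proof.
pose v : 'cV[C]_d.+1 := delta_mx ord0 0.
have v1 : vnorm2 v = 1.
  by apply: complexI; rewrite vnorm2E trmx_delta map_delta_mx mul_delta_mx mxE !eqxx.
apply: (@le_trans _ _ (\sum_b complex.Re ((v^t* *m block f b *m v) 0 0))); last first.
  by apply: ler_sum => b _; apply: quad_le_opnorm => //; exact: psdmx_block.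
have -> : \sum_b complex.Re ((v^t* *m block f b *m v) 0 0) =
          complex.Re ((v^t* *m (\sum_b block f b) *m v) 0 0).
  rewrite mulmx_sumr mulmx_suml summxE.
  by rewrite (raddf_sum (@complex.Re R : Rcomplex R -> R)).
have -> : \sum_b block f b = 1%:M.
  rewrite -sum1 (partition_big f xpredT) //=.
by rewrite mulmx1 -vnorm2E v1.
Qed.

(** The average of [expR (D * norm)] is at most [D * expR c], and Jensen's inequality bounds the
    average of [D * norm] by [ln D + c]. *)
Lemma sum_opnorm_block_le (b : 'I_r) :
  \sum_f opnorm (block f b) <=
  (r ^ n)%:R * ((ln D + 172 / 100 * D / r%:R) / D).
Proof.
have r0 : (0 < r)%N by apply: leq_ltn_trans (ltn_ord b).
have D0 : 0 < D by rewrite ltr0n.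
pose c := 172 / 100 * D / r%:R.
have c0 : 0 <= c by rewrite /c !mulr_ge0 ?invr_ge0.
rewrite mulrA ler_pdivlMr // mulrC mulr_sumr.
have cardE : #|{ffun 'I_n -> 'I_r}| = (r ^ n)%N by rewrite card_ffun !card_ord.
have -> : ln D + c = ln (D * expR c) by rewrite lnM ?posrE ?expR_gt0 // expRK.
rewrite -cardE; apply: jensen_expR; rewrite ?cardE ?expn_gt0 ?r0 ?mulr_gt0 ?expR_gt0 //.
apply: sum_expR_le => N.
apply: (@le_trans _ _ ((r ^ n)%:R * (D * texp N.+1 c))); last first.
  by rewrite !ler_wpM2l // texp_le_expR.
rewrite -lecR rmorph_sum /=.
(* Scaling by [D] turns [alpha i <= 1 / D] into the bound [a i <= 1] that the rank-one replacement
   requires. *)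
pose a i := (D * alpha i)%:C.
have a0 i : 0 <= a i by rewrite ler0c mulr_ge0.
have a1 i : a i <= 1.
  by rewrite -(rmorph1 (real_complex R)) lecR mulrC -ler_pdivlMr.
have v1 i : ((psi i)^t* *m psi i) 0 0 = 1 by rewrite -vnorm2E psi1.
have := sum_trexp_le N b (psdmx0 C d.+1) v1 a0 a1.
rewrite add0r.
(* Since the POVM sums to the identity, the scaled means add up to a scalar matrix. *)
have -> : \sum_i (r%:R^-1 * (172 / 100) * a i) *: (psi i *m (psi i)^t*) = (c%:C)%:M.
  rewrite -scalemx1 -sum1 scaler_sumr; apply: eq_bigr => i _.
  rewrite scalerA; congr (_ *: _); rewrite /c /a !rmorphM !fmorphV !rmorph_nat /=.
  by ring.
rewrite trexp_scalar -texpC => h.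
rewrite !rmorphM !rmorph_nat; apply: le_trans h; apply: ler_sum => f _.
rewrite add0r; apply: le_trans (texp_opnorm_le (psdmx_block f b) N.+1 (ler0n _ _)) _.
rewrite scaler_sumr le_eqVlt; apply/predU1P; left; congr trexp.
by apply: eq_bigr => i _; rewrite scalerA /a rmorphM.
Qed.
End Blocks.

(** * Failure probabilities of the two conditions and the union bound *)

Theorem theorem7 (R : realType) (d n r : nat) (M : 'I_n -> 'M[complex R]_d)
    (alpha : 'I_n -> R) (psi : 'I_n -> 'cV[complex R]_d) (C delta : R) :
  (2 <= d)%N ->
  is_POVM M ->
  (forall i, vnorm2 (psi i) = 1) ->
  (forall i, M i = @Complex R (alpha i) 0 *: (psi i *m adjmx (psi i))) ->
  (n <= 2 * d ^ 2)%N ->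
  (forall i, alpha i <= 1 / d%:R) ->
  0 < C -> (0 < r)%N -> r%:R = C * d%:R ->
  0 < delta -> delta <= 1 ->
  delta ^+ 3 >= 3 * C / (2 * d%:R) * (1 + ln (4 * C * d%:R)) ->
  (#|[set f : {ffun 'I_n -> 'I_r} |
        (qval M f >= 1 / (344%:R / 100%:R + 2 * C * ln d%:R)) &&
        [forall b : 'I_r, (#|[set i | f i == b]|%:R <= 2 / C * (1 + delta) * d%:R :> R)]]|%:R
     / (r ^ n)%:R : R) >= 1 / 4.
Proof.
(* Dimension zero is excluded by [2 <= d]; from here on the dimension is [d.+1], written [D] as a
   real. *)
case: d M psi => // d M psi d2 [psdM sumM] psi1 ME n_le alpha_le C0 r0 rE dl0 dl1 dl3.
set D : R := d.+1%:R in alpha_le rE dl3 *.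
have D0 : 0 < D by rewrite ltr0n.
have Dnz : 1 + d%:R != 0 :> R by rewrite nat1r pnatr_eq0.
have Cnz : C != 0 by rewrite gt_eqF.
have {}ME i : M i = (alpha i)%:C%C *: (psi i *m (psi i)^t*%sesqui) by rewrite ME adjmxE.
(* The quadratic form of [M i] at the unit vector [psi i] equals [alpha i]. *)
have alpha_ge0 i : 0 <= alpha i.
  have [_ /(_ (psi i))] := psdM i; rewrite ME adjmxE -scalemxAr -scalemxAl mxE.
  have -> : ((psi i)^t* *m (psi i *m (psi i)^t*) *m psi i =
             ((psi i)^t* *m psi i) *m ((psi i)^t* *m psi i))%sesqui.
    by rewrite !mulmxA.
  rewrite [((_ *m _) *m _) 0 0]mxE big_ord1 -!vnorm2E psi1.
  by rewrite /= !mulr1 !mul0r !subr0 mulr1.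
have sum1 : \sum_i (alpha i)%:C%C *: (psi i *m (psi i)^t*%sesqui) = 1%:M.
  by rewrite -sumM; apply: eq_bigr => i _; rewrite ME.
pose S (f : {ffun 'I_n -> 'I_r}) := \sum_(b < r) opnorm (\sum_(i < n | f i == b) M i).
have blockE f b : \sum_(i < n | f i == b) M i =
    \sum_(i < n | f i == b) (alpha i)%:C%C *: (psi i *m (psi i)^t*%sesqui).
  by apply: eq_bigr => i _; rewrite ME.
have S1 f : 1 <= S f.
  rewrite /S; under eq_bigr => b _ do rewrite blockE.
  exact: sum_opnorm_block_ge1.
(* [K] is half of [3.44 + 2 * C * ln D]. It bounds the mean of [S]: [r] blocks contribute
   [(ln D + 1.72 * D / r) / D] each, and [r / D = C]. *)
pose K := 172 / 100 + C * ln D.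
have lnD0 : 0 <= ln D by rewrite ln_ge0 // ler1n.
have ClnD0 : 0 <= C * ln D by rewrite mulr_ge0 // ltW.
have K0 : 0 < K by rewrite /K; lra.
have rp : 0 < r%:R :> R by rewrite ltr0n.
have rn0 : 0 < (r ^ n)%:R :> R by rewrite ltr0n expn_gt0 r0.
have sumS : \sum_f S f <= (r ^ n)%:R * K.
  rewrite /S exchange_big /=.
  apply: (@le_trans _ _ (\sum_(b < r) (r ^ n)%:R * ((ln D + 172 / 100 * D / r%:R) / D))).
    apply: ler_sum => b _; under eq_bigr => f _ do rewrite blockE.
    exact: sum_opnorm_block_le.
  rewrite sumr_const card_ord -mulrnAr ler_wpM2l ?ler0n // -mulr_natl rE le_eqVlt.
  by apply/predU1P; left; rewrite /K; field; rewrite Dnz.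
have bad1 : #|[set f | 2 * K < S f]|%:R * 2 <= (r ^ n)%:R :> R.
  have := card_markov (2 * K) (fun f => le_trans ler01 (S1 f)).
  by move=> /le_trans/(_ sumS); rewrite mulrA ler_pM2r.
(* From [n <= 2 * D ^ 2] and [r = C * D], the mean block size is at most [mu]. *)
pose mu := 2 / C * D.
have bad2 (b : 'I_r) : #|[set f : {ffun 'I_n -> 'I_r} |
      mu * (1 + delta) < #|[set i | f i == b]|%:R]|%:R * (4 * r%:R) <= (r ^ n)%:R :> R.
  have n_le' : n%:R <= mu * r%:R :> R.
    have -> : mu * r%:R = (2 * d.+1 ^ 2)%:R.
      by rewrite natrM natrX rE /mu -/D; field.
    by rewrite ler_nat.
  have := block_size_tail b n_le' dl0 dl1; rewrite -ler_pdivlMr ?mulr_gt0 // => /le_trans; apply.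
  rewrite ler_wpM2l ?ler0n // -[X in _ <= X^-1]lnK ?posrE ?mulr_gt0 // -expRN ler_expR lerN2.
  have -> : 4 * r%:R = 4 * C * D :> R by rewrite rE mulrA.
  (* Since [delta <= 1], [delta ^+ 2] may be lowered to [delta ^+ 3]. The hypothesis on [delta] then
     applies, as [mu / 3] times [3 * C / (2 * D)] is 1. *)
  apply: (@le_trans _ _ (mu * delta ^+ 3 / 3)); last first.
    rewrite ler_wpM2r ?invr_ge0 // ler_wpM2l ?mulr_ge0 ?invr_ge0 ?(ltW C0) ?(ltW D0) //.
    by rewrite exprS ler_piMl ?exprn_ge0 // ltW.
  have mu3 : 0 <= mu / 3 by rewrite !mulr_ge0 ?invr_ge0 ?(ltW C0) ?(ltW D0).
  have := ler_wpM2l mu3 dl3.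
  have -> : mu / 3 * (3 * C / (2 * D) * (1 + ln (4 * C * D))) = 1 + ln (4 * C * D).
    by rewrite /mu; field; rewrite Dnz.
  by move=> h; rewrite [leRHS]mulrAC; apply: le_trans h; rewrite lerDr.
(* Union bound: each assignment satisfies both conditions or is counted in a failure set. *)
have total : (r ^ n)%:R <= #|[set f : {ffun 'I_n -> 'I_r} |
        (qval M f >= 1 / (344%:R / 100%:R + 2 * C * ln D)) &&
        [forall b : 'I_r, (#|[set i | f i == b]|%:R <= 2 / C * (1 + delta) * D :> R)]]|%:R +
   (#|[set f | 2 * K < S f]|%:R + \sum_(b < r) #|[set f : {ffun 'I_n -> 'I_r} |
      mu * (1 + delta) < #|[set i | f i == b]|%:R]|%:R) :> R.
  have -> : (r ^ n)%:R = \sum_(f : {ffun 'I_n -> 'I_r}) 1 :> R.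
    by rewrite sumr_const card_ffun !card_ord.
  under [\sum_(b < r) _]eq_bigr => b _ do rewrite natr_card_set.
  rewrite exchange_big !natr_card_set -!big_split /=; apply: ler_sum => f _.
  have s0 : 0 <= \sum_(b < r) (mu * (1 + delta) < #|[set i | f i == b]|%:R)%R%:R :> R.
    by apply: sumr_ge0.
  have [hS|hS] := ltP (2 * K) (S f); first by rewrite addrCA lerDl addr_ge0.
  rewrite add0r.
  have -> : 1 / (344 / 100 + 2 * C * ln D) <= qval M f.
    rewrite /qval -/(S f) div1r lef_pV2 ?posrE ?(lt_le_trans ltr01) //.
      by apply: le_trans hS _; rewrite /K; lra.
    lra.
  case: forallP => [_|] /=; first by rewrite lerDl.
  move=> /existsNP [b /negP]; rewrite -ltNge => hb.
  rewrite add0r (bigD1 b) //= (_ : _ < _ = true) ?lerDl ?sumr_ge0 //.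
  by rewrite /mu mulrAC.
have bad2s : (\sum_(b < r) #|[set f : {ffun 'I_n -> 'I_r} |
      mu * (1 + delta) < #|[set i | f i == b]|%:R]|%:R) * 4 <= (r ^ n)%:R :> R.
  rewrite -(ler_pM2r rp) mulr_suml mulr_suml.
  apply: (@le_trans _ _ (\sum_(b < r) (r ^ n)%:R)).
    by apply: ler_sum => b _; rewrite -mulrA.
  by rewrite sumr_const card_ord mulr_natr.
(* At least [1 - 1 / 2 - 1 / 4] of the assignments remain. *)
rewrite ler_pdivlMr //; lra.
Qed.
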